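(* Let $\Omega$ be an open subset of $\mathbb{R}^n$ and let $f\in\mathscr{C}^\infty(\Omega)$ (with values in $\mathbb{K}$) be an open mapping. Then for every open subset $W\subset\Omega$ the set $\kappa(f)(\tilde{W}_c)$ is open in $\overline{\mathbb{K}}$.
   Context: $\mathbb{K}$ is $\mathbb{R}$ or $\mathbb{C}$; $I_\eta=]0,\eta[$ for $\eta\in]0,1]$. Mollifiers. $\mathcal{A}_0(\mathbb{K})$ is the set of even test functions $\varphi\in\mathcal{D}(\mathbb{R})$, constant near $0$, with $\int_0^\infty\varphi(x)\,dx=\frac12$. For $q\in\mathbb{N}$, $\mathcal{A}_q(\mathbb{K})$ is the set of $\varphi\in\mathcal{A}_0(\mathbb{K})$ with $\int_0^\infty x^{j/m}\varphi(x)\,dx=0$ for $1\le j,m\le q$. For $\varepsilon>0$, $\varphi_\varepsilon(x)=\varepsilon^{-1}\varphi(x/\varepsilon)$. $i(\varphi)$ is the diameter of $\operatorname{supp}\varphi$; by convention $\varphi$ is normalized by $i(\varphi)=1$ whenever $\varphi_\varepsilon$ is written, so $i(\varphi_\varepsilon)=\varepsilon$. $\Gamma$ is the set of strictly increasing $\gamma:\mathbb{N}\to\mathbb{R}_+$ with $\gamma(n)\to\infty$. Generalized numbers. $\overline{\mathbb{K}}=\mathcal{E}_M(\mathbb{K})/\mathcal{N}(\mathbb{K})$, where $\mathcal{E}_M(\mathbb{K})$ is the ring of $u:\mathcal{A}_0(\mathbb{K})\to\mathbb{K}$ for which there is $N\in\mathbb{N}$ such that for all $\varphi\in\mathcal{A}_N(\mathbb{K})$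 there are $c=c(\varphi)>0$, $\eta=\eta(\varphi)\in]0,1]$ with $|u(\varphi_\varepsilon)|\le c\varepsilon^{-N}$ for $\varepsilon\in I_\eta$, and $\mathcal{N}(\mathbb{K})$ is the ideal of those $u$ for which there are $N\in\mathbb{N}$, $\gamma\in\Gamma$ such that for all $q\ge N$, $\varphi\in\mathcal{A}_q(\mathbb{K})$ there are $c,\eta>0$ with $|u(\varphi_\varepsilon)|\le c\varepsilon^{\gamma(q)-N}$ for $\varepsilon\in I_\eta$. $v\approx0$ if there is $p$ with $\lim_{\varepsilon\downarrow0}v(\varphi_\varepsilon)=0$ for all $\varphi\in\mathcal{A}_p(\mathbb{K})$. $\dot\alpha_r$ is the class of $\varphi\mapsto i(\varphi)^r$. $V(x)=\sup\{r\in\mathbb{R}:\dot\alpha_{-r}x\approx0\}$, $\|x\|=e^{-V(x)}$; $(x,y)\mapsto\|x-y\|$ is an ultrametric defining the topology (sharp topology) of $\overline{\mathbb{K}}$. Generalized points. For $W\subset\mathbb{R}^n$ open, $\tilde W_c$ is the set of classes of families $(x_\varphi)\in W^{\mathcal{A}_0(\mathbb{K})}$ for which there are a compact $L\subset W$ and $p\in\mathbb{N}$ such that for all $\varphi\in\mathcal{A}_p(\mathbb{K})$ there is $\eta>0$ with $x_{\varphi_\varepsilon}\in L$ for $\varepsilon\in I_\eta$, modulo $(x_\varphi)\sim(y_\varphi)$ iff there are $p\in\mathbb{N}$, $\gamma\in\Gamma$ such that for all $q\ge p$, $\varphi\in\mathcal{A}_q(\mathbb{K})$ there are $c,\eta>0$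 with $|x_{\varphi_\varepsilon}-y_{\varphi_\varepsilon}|\le c\varepsilon^{\gamma(q)-p}$ for $\varepsilon\in I_\eta$. For $W\subset\Omega$, $\tilde W_c\subset\tilde\Omega_c$. For $f\in\mathscr{C}^\infty(\Omega)$, viewed as the element of the Colombeau algebra $\mathcal{G}(\Omega)$ with representative $f_\varphi=f$ for all $\varphi$, $\kappa(f):\tilde\Omega_c\to\overline{\mathbb{K}}$ is $\kappa(f)(x)=$ class of $(f(x_\varphi))_\varphi$ for $x$ represented by $(x_\varphi)$. *)

(* Defs.v *)
From HB Require Import structures.
From mathcomp Require Import all_boot all_order all_algebra.
From mathcomp Require Import all_classical all_reals all_analysis.
From mathcomp Require Import complex lra.
Import Order.TTheory GRing.Theory Num.Theory.
Import numFieldNormedType.Exports.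
Import Quotient.Exports.

Set Implicit Arguments.
Unset Strict Implicit.
Unset Printing Implicit Defensive.

Local Open Scope classical_set_scope.
Local Open Scope ring_scope.
Local Open Scope quotient_scope.

Variant scalar_kind := RealScalars | ComplexScalars.

Definition scalars (R : realType) (k : scalar_kind) : numFieldType :=
  match k with RealScalars => R | ComplexScalars => R[i] end.

Section Scalars.
Variables (R : realType) (k : scalar_kind).
Local Notation K := (scalars R k).

Definition real_part : K -> R :=
  match k return scalars R k -> R with
  | RealScalars => id
  | ComplexScalars => @complex.Re R
  end.

Definition imag_part : K -> R :=
  match k return scalars R k -> R with
  | RealScalars => fun=> 0
  | ComplexScalars => @complex.Im R
  end.

Definition scalar_of (a b : R) : K :=
  match k return scalars R k with
  | RealScalars => a
  | ComplexScalars => a +i* b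
  end%C.

Definition of_real (a : R) : K := scalar_of a 0.

(* The norm of a numFieldType takes its (real) values in the field itself. *)
Definition modulus (z : K) : R := real_part `|z|.

Definition scalar_integral (D : set R) (h : R -> K) : K :=
  scalar_of (\int[lebesgue_measure]_(x in D) real_part (h x))
            (\int[lebesgue_measure]_(x in D) imag_part (h x)).

Lemma real_part_scale (a : R) z : real_part (of_real a * z) = a * real_part z.
Proof.
rewrite /of_real /real_part /scalar_of; case: (k) z => //= -[x y] /=.
by rewrite mul0r subr0.
Qed.

Lemma imag_part_scale (a : R) z : imag_part (of_real a * z) = a * imag_part z.
Proof.
rewrite /of_real /imag_part /scalar_of; case: (k) z => [?|[x y]] /=.
  by rewrite mulr0.
by rewrite mul0r addr0.
Qed.

Lemma of_real_eq0 a : (of_real a == 0) = (a == 0).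
Proof. by rewrite /of_real /scalar_of; case: (k) => //=; rewrite eq_complex /= eqxx andbT. Qed.

Lemma modulusE z : of_real (modulus z) = `|z|.
Proof. by rewrite /of_real /modulus /real_part /scalar_of; case: (k) z => [|]//= -[]. Qed.

Lemma of_real_le a b : (of_real a <= of_real b) = (a <= b).
Proof. by rewrite /of_real /scalar_of; case: (k) => //=; rewrite lecR. Qed.

Lemma modulus_ge0 z : 0 <= modulus z.
Proof.
by rewrite -of_real_le modulusE /of_real /scalar_of; case: (k) z => z; exact: normr_ge0.
Qed.

Lemma modulus0 : modulus 0 = 0.
Proof. by rewrite /modulus normr0 /real_part; case: (k). Qed.

Lemma modulus1 : modulus 1 = 1.
Proof. by rewrite /modulus normr1 /real_part; case: (k). Qed.

Lemma modulusD y z : modulus (y + z) <= modulus y + modulus z.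
Proof.
suff : of_real (modulus (y + z)) <= of_real (modulus y + modulus z).
  by rewrite of_real_le.
suff -> : of_real (modulus y + modulus z) = of_real (modulus y) + of_real (modulus z).
  by rewrite !modulusE; exact: ler_normD.
by rewrite /of_real /scalar_of; case: (k) => //=; simpc.
Qed.

Lemma modulusN z : modulus (- z) = modulus z.
Proof. by rewrite /modulus normrN. Qed.

Lemma modulusM y z : modulus (y * z) = modulus y * modulus z.
Proof.
rewrite {1}/modulus normrM -[in LHS]modulusE real_part_scale.
by rewrite /modulus.
Qed.

Lemma modulus_le z : modulus z <= `|real_part z| + `|imag_part z|.
Proof.
rewrite /modulus /real_part /imag_part; case: (k) z => [z|[x y]] /=.
  by rewrite normr0 addr0.
rewrite -[leRHS]ger0_norm ?addr_ge0 // -sqrtr_sqr ler_wsqrtr // sqrrD !real_normK ?num_real //.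
by rewrite lerD2r lerDl mulrn_wge0 // mulr_ge0.
Qed.

End Scalars.

Arguments scalar_of {R k} a b.
Arguments of_real {R k} a.

Section Mollifiers.
Variables (R : realType) (k : scalar_kind).
Local Notation K := (scalars R k).

Definition smooth1 (g : R -> R) : Prop :=
  forall j x, derivable (derive1n j g) x 1.

Definition support (phi : R -> K) : set R := closure [set x | phi x != 0].

Definition test_function (phi : R -> K) : Prop :=
  [/\ smooth1 (fun x => real_part (phi x)),
      smooth1 (fun x => imag_part (phi x)) & compact (support phi)].

Definition is_mollifier (phi : R -> K) : Prop :=
  [/\ test_function phi,
      forall x, phi (- x) = phi x,
      \forall x \near 0, phi x = phi 0 &
      scalar_integral `[0, +oo[ phi = 2^-1].

Definition mollifier := {phi : R -> K | is_mollifier phi}.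

Definition rescale_fun (eps : R) (phi : R -> K) : R -> K :=
  fun x => of_real eps^-1 * phi (x / eps).

Let derive1n_rescale (c a : R) (g : R -> R) j : smooth1 g ->
  derive1n j (fun x => c * g (x * a)) = (fun x => c * a ^+ j * derive1n j g (x * a)).
Proof.
move=> sg; elim: j => [|j IH]; first by apply/funext => x; rewrite mulr1.
rewrite derive1nS IH; apply/funext => x; rewrite derive1E.
have gd : is_derive (x * a) (1 : R) (derive1n j g) (derive1n j.+1 g (x * a)).
  by apply: DeriveDef; [exact: sg | rewrite derive1nS derive1E].
have h : is_derive x (1 : R) (fun y : R => y * a) a.
  have -> : (fun y : R => y * a) = (a \*: @idfun R) by apply/funext => y; rewrite mulrC.
  by apply: is_derive_eq; rewrite /GRing.scale /= mulr1.
have h2 := @is_derive1_comp _ _ (fun y => y * a) _ _ _ gd h.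
have h3 := is_deriveZ (c * a ^+ j) h2.
rewrite (@derive_val _ _ _ _ _ _ _ h3).
by rewrite /GRing.scale /= exprSr -!mulrA; congr (_ * _); congr (_ * _); rewrite mulrC.
Qed.

Let smooth1_rescale (c a : R) (g : R -> R) : smooth1 g ->
  smooth1 (fun x => c * g (x * a)).
Proof.
move=> sg j x; rewrite derive1n_rescale //.
have h : derivable (fun y : R => y * a) x 1.
  have -> : (fun y : R => y * a) = (a \*: @idfun R) by apply/funext => y; rewrite mulrC.
  exact: derivableZ.
apply: derivableZ; apply/derivable1_diffP.
rewrite (_ : (fun _ => _) = derive1n j g \o (fun y => y * a)) //.
by apply: differentiable_comp; apply/derivable1_diffP => //; exact: sg.
Qed.

Let integral_rescale (eps : R) (g : R -> R) : 0 < eps -> smooth1 g ->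
  \int[lebesgue_measure]_(x in `[0, +oo[) (eps^-1 * g (x / eps)) =
  \int[lebesgue_measure]_(x in `[0, +oo[) g x.
Proof.
move=> e0 sg; rewrite /Rintegral; congr fine.
have ei0 : 0 < eps^-1 by rewrite invr_gt0.
pose F : R -> R := fun x => x / eps.
have FE : F = (eps^-1 \*: @idfun R) by apply/funext => y; rewrite /F mulrC.
have dF x : is_derive x (1 : R) F eps^-1.
  by rewrite FE; apply: is_derive_eq; rewrite /GRing.scale /= mulr1.
have dFE : derive1 F = cst eps^-1.
  by apply/funext => x; rewrite derive1E (@derive_val _ _ _ _ _ _ _ (dF x)).
have cF : continuous F.
  by move=> x; apply: differentiable_continuous; apply/derivable1_diffP; case: (dF x).
have cg : continuous g.
  by move=> x; apply: differentiable_continuous; apply/derivable1_diffP; exact: (sg 0%N).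
have key (G : R -> R) : continuous G -> (forall x, 0 <= G x) ->
    (\int[lebesgue_measure]_(x in `[0%R, +oo[) (G x)%:E =
     \int[lebesgue_measure]_(x in `[0%R, +oo[) ((G (x / eps)) * eps^-1)%:E)%E.
  move=> cG G0.
  have F0 : F 0 = 0 by rewrite /F mul0r.
  rewrite -[in LHS]F0 (@increasing_ge0_integration_by_substitutiony _ F G 0).
  - by apply: eq_integral => x _; rewrite dFE.
  - by move=> x y _ _ xy; rewrite /F ltr_pM2r.
  - by rewrite dFE => x _; exact: cvg_cst.
  - by rewrite dFE; exact: is_cvg_cst.
  - by rewrite dFE; exact: is_cvg_cst.
  - split; first by move=> x _; case: (dF x).
    by apply: cvg_at_right_filter; exact: cF.
  - by apply: gt0_cvgMly => //; exact: cvg_id.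
  - exact: continuous_subspaceT.
  - by move=> x _.
have cpos (h : R -> R) : continuous h -> continuous (h^\+)%R.
  by move=> ch x; apply: continuous_max; [exact: ch|exact: cvg_cst].
have keyp (h : R -> R) : continuous h ->
    (\int[lebesgue_measure]_(x in `[0%R, +oo[) ((fun x => (eps^-1 * h (x / eps))%:E)^\+ x) =
     \int[lebesgue_measure]_(x in `[0%R, +oo[) ((fun x => (h x)%:E)^\+ x))%E.
  move=> ch; transitivity (\int[lebesgue_measure]_(x in `[0%R, +oo[) ((h^\+)%R x)%:E)%E; last first.
    by apply: eq_integral => x _; rewrite -[RHS]/((EFin \o h)^\+ x)%E funerpos.
  apply/esym; rewrite key; [|exact: cpos|by move=> x; exact: funrpos_ge0].
  apply: eq_integral => x _.
  pose he x := eps^-1 * h (x / eps).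
  rewrite -[RHS]/((EFin \o he)^\+ x)%E funerpos /= /he.
  congr EFin.
  by rewrite /funrpos maxr_pMl ?mul0r 1?[in RHS]mulrC // ltW.
rewrite integralE [in RHS]integralE.
congr (_ - _)%E; first exact/keyp.
have cNg : continuous (\- g) by move=> x; apply: continuousN; exact: cg.
have := keyp _ cNg.
rewrite (_ : (fun x => (eps^-1 * (\- g) (x / eps))%:E) =
             (\- (fun x => (eps^-1 * g (x / eps))%:E))%E); last first.
  by apply/funext => x; rewrite /= mulrN.
by rewrite -!funeposN.
Qed.

Let compact_support_rescale (eps : R) (phi : R -> K) : 0 < eps ->
  compact (support phi) -> compact (support (rescale_fun eps phi)).
Proof.
move=> e0 cphi.
have e1 : eps != 0 by rewrite gt_eqF.
have cim : compact ((fun x => eps * x) @` support phi).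
  apply: continuous_compact => //; apply: continuous_subspaceT => x.
  by apply: cvgMl_tmp; exact: cvg_id.
apply: (subclosed_compact (@closed_closure _ _) cim).
have clim : closed ((fun x => eps * x) @` support phi).
  exact: compact_closed.
rewrite /support (closure_id ((fun x => eps * x) @` support phi)).1 //.
apply: closureS => x /=; rewrite /rescale_fun mulf_eq0 negb_or => /andP[_ px].
exists (x / eps); last by rewrite mulrCA divff // mulr1.
exact: subset_closure.
Qed.

Lemma is_mollifier_rescale (eps : R) (phi : R -> K) : 0 < eps ->
  is_mollifier phi -> is_mollifier (rescale_fun eps phi).
Proof.
move=> e0 [[sre sim cphi] even near0 int]; split.
- split; last exact: compact_support_rescale.
    rewrite (_ : (fun x => _) = (fun x => eps^-1 * real_part (phi (x * eps^-1)))).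
      exact: (@smooth1_rescale eps^-1 eps^-1 (fun x => real_part (phi x))).
    by apply/funext => x; rewrite /rescale_fun real_part_scale.
  rewrite (_ : (fun x => _) = (fun x => eps^-1 * imag_part (phi (x * eps^-1)))).
    exact: (@smooth1_rescale eps^-1 eps^-1 (fun x => imag_part (phi x))).
  by apply/funext => x; rewrite /rescale_fun imag_part_scale.
- by move=> x; rewrite /rescale_fun mulNr even.
- have c0 : (fun x : R => x / eps) @ (0 : R) --> (0 : R).
    by rewrite -[X in _ --> X](mul0r eps^-1); apply: cvgMr_tmp; exact: cvg_id.
  near=> x; have /= px : phi (x / eps) = phi 0 by near: x; exact: (c0 _ near0).
  by rewrite /rescale_fun px mul0r.
- rewrite -int /scalar_integral; congr scalar_of.
    rewrite -[RHS](@integral_rescale eps (fun x => real_part (phi x))) //.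
    by apply: eq_Rintegral => x _; rewrite /rescale_fun real_part_scale.
  rewrite -[RHS](@integral_rescale eps (fun x => imag_part (phi x))) //.
  by apply: eq_Rintegral => x _; rewrite /rescale_fun imag_part_scale.
Unshelve. all: by end_near. Qed.

(* [rescale phi eps] is phi_eps; it is only meant for eps > 0. *)
Definition rescale (phi : mollifier) (eps : R) : mollifier :=
  match @idP (0 < eps) with
  | ReflectT e0 => exist _ _ (is_mollifier_rescale e0 (svalP phi))
  | ReflectF _ => phi
  end.

(* i(phi) *)
Definition diam (phi : mollifier) : R :=
  sup [set `|xy.1 - xy.2| | xy in support (sval phi) `*` support (sval phi)].

Definition A_ (q : nat) : set mollifier := [set phi | forall j m : nat,
  (1 <= j <= q)%N -> (1 <= m <= q)%N ->
  scalar_integral `[0, +oo[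
    (fun x => of_real (x `^ (j%:R / m%:R)) * sval phi x) = 0].

(* The phi_eps are only formed for phi normalized by i(phi) = 1, so that
   i(phi_eps) = eps. *)
Definition normalized_A (q : nat) : set mollifier :=
  A_ q `&` [set phi | diam phi = 1].

Lemma normalized_A_le p q : (p <= q)%N -> normalized_A q `<=` normalized_A p.
Proof.
move=> pq phi [Aq d]; split => // j m /andP[j1 jp] /andP[m1 mp].
by apply: Aq; rewrite ?j1 ?m1 (leq_trans _ pq).
Qed.

End Mollifiers.

Section GeneralizedScalars.
Variables (R : realType) (k : scalar_kind).
Local Notation K := (scalars R k).
Local Notation mollifier := (mollifier R k).

Definition Gamma : set (nat -> R) := [set g | [/\ forall n, 0 <= g n,
  {homo g : m n / (m < n)%N >-> m < n} & g n @[n --> \oo] --> +oo]].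

Definition moderate_bound (a : mollifier -> R) : Prop :=
  exists N : nat, forall phi, normalized_A N phi ->
    exists c eta : R, [/\ 0 < c, 0 < eta <= 1 &
      forall eps, 0 < eps < eta -> a (rescale phi eps) <= c * eps ^- N].

Definition null_bound (a : mollifier -> R) : Prop :=
  exists (N : nat) (g : nat -> R), Gamma g /\
    forall q phi, (N <= q)%N -> normalized_A q phi ->
    exists c eta : R, [/\ 0 < c, 0 < eta <= 1 &
      forall eps, 0 < eps < eta ->
        a (rescale phi eps) <= c * eps `^ (g q - N%:R)].

Lemma moderate_boundD a b (c : mollifier -> R) : moderate_bound a ->
  moderate_bound b -> (forall phi, c phi <= a phi + b phi) -> moderate_bound c.
Proof.
move=> [N1 h1] [N2 h2] cab; exists (N1 + N2)%N => phi Aphi.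
have [c1 [e1 [c10 /andP[e10 e11] h1']]] := h1 phi (normalized_A_le (leq_addr _ _) Aphi).
have [c2 [e2 [c20 /andP[e20 e21] h2']]] := h2 phi (normalized_A_le (leq_addl _ _) Aphi).
exists (c1 + c2), (Num.min e1 e2); split.
- exact: addr_gt0.
- by rewrite lt_min e10 e20 ge_min e11.
move=> eps /andP[ep0]; rewrite lt_min => /andP[ep1 ep2].
rewrite (le_trans (cab _)) // mulrDl lerD //.
  rewrite (le_trans (h1' _ _)) ?ep0 // ler_pM2l // -!exprVn.
  by rewrite ler_weXn2l ?leq_addr // invf_ge1 // ltW // (lt_le_trans ep1).
rewrite (le_trans (h2' _ _)) ?ep0 // ler_pM2l // -!exprVn.
by rewrite ler_weXn2l ?leq_addl // invf_ge1 // ltW // (lt_le_trans ep1).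
Qed.

Lemma moderate_boundM a b : (forall phi, 0 <= a phi) -> (forall phi, 0 <= b phi) ->
  moderate_bound a -> moderate_bound b -> moderate_bound (fun phi => a phi * b phi).
Proof.
move=> a0 b0 [N1 h1] [N2 h2]; exists (N1 + N2)%N => phi Aphi.
have [c1 [e1 [c10 /andP[e10 e11] h1']]] := h1 phi (normalized_A_le (leq_addr _ _) Aphi).
have [c2 [e2 [c20 /andP[e20 e21] h2']]] := h2 phi (normalized_A_le (leq_addl _ _) Aphi).
exists (c1 * c2), (Num.min e1 e2); split.
- exact: mulr_gt0.
- by rewrite lt_min e10 e20 ge_min e11.
move=> eps /andP[ep0]; rewrite lt_min => /andP[ep1 ep2].
rewrite -exprVn exprD mulrACA ler_pM // exprVn; first by rewrite h1' ?ep0.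
by rewrite h2' ?ep0.
Qed.

Lemma null_boundD a b (c : mollifier -> R) : null_bound a -> null_bound b ->
  (forall phi, c phi <= a phi + b phi) -> null_bound c.
Proof.
move=> [N1 [g1 [[g10 g1i g1y] h1]]] [N2 [g2 [[g20 g2i g2y] h2]]] cab.
pose g q := Num.min (g1 q) (g2 q).
exists (N1 + N2)%N, g; split.
  split.
  - by move=> n; rewrite le_min g10 g20.
  - move=> m n mn; rewrite /g lt_min !gt_min.
    by rewrite (g1i _ _ mn) (g2i _ _ mn) orbT.
  - apply/cvgryPge => A; near=> n; rewrite le_min; apply/andP; split; near: n.
      exact: (cvgryPge _).1.
    exact: (cvgryPge _).1.
move=> q phi Nq Aphi.
have [c1 [e1 [c10 /andP[e10 e11] h1']]] := h1 q phi (leq_trans (leq_addr _ _) Nq) Aphi.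
have [c2 [e2 [c20 /andP[e20 e21] h2']]] := h2 q phi (leq_trans (leq_addl _ _) Nq) Aphi.
exists (c1 + c2), (Num.min e1 e2); split.
- exact: addr_gt0.
- by rewrite lt_min e10 e20 ge_min e11.
move=> eps /andP[ep0]; rewrite lt_min => /andP[ep1 ep2].
have eps1 : 0 < eps <= 1 by rewrite ep0 ltW // (lt_le_trans ep1).
rewrite (le_trans (cab _)) // mulrDl lerD //.
  rewrite (le_trans (h1' _ _)) ?ep0 // ler_pM2l //; apply: ger_powR => //.
  by rewrite lerB ?ge_min ?lexx // ler_nat leq_addr.
rewrite (le_trans (h2' _ _)) ?ep0 // ler_pM2l //; apply: ger_powR => //.
by rewrite lerB ?ge_min ?lexx ?orbT // ler_nat leq_addl.
Unshelve. all: by end_near. Qed.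

Lemma null_bound0 : null_bound (fun=> 0).
Proof.
exists 0%N, (fun n => n%:R); split.
  split => //; first by move=> m n mn; rewrite ltr_nat.
  exact: cvgr_idn.
move=> q phi _ _; exists 1, 1; split => //; first by rewrite ltr01 lexx.
by move=> eps _; rewrite mul1r powR_ge0.
Qed.

Lemma null_bound_le (a b : mollifier -> R) : (forall phi, a phi <= b phi) ->
  null_bound b -> null_bound a.
Proof.
by move=> ab hb; apply: null_boundD hb null_bound0 _ => phi; rewrite addr0.
Qed.

Definition moderate : {pred mollifier -> K} :=
  [pred u | `[< moderate_bound (fun phi => modulus (u phi)) >]].

Lemma moderate_subring_closed : subring_closed moderate.
Proof.
split.
- apply/asboolP; exists 0%N => phi _; exists 1, 1; split => //; first by rewrite ltr01 lexx.
  by move=> eps _; rewrite modulus1 expr0 invr1 mulr1.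
- move=> u v /asboolP hu /asboolP hv; apply/asboolP.
  by apply: moderate_boundD hu hv _ => phi; rewrite (le_trans (modulusD _ _)) // modulusN.
- move=> u v /asboolP hu /asboolP hv; apply/asboolP.
  rewrite (_ : (fun phi => _) = (fun phi => modulus (u phi) * modulus (v phi))).
    by apply: moderate_boundM => // phi; exact: modulus_ge0.
  by apply/funext => phi; rewrite modulusM.
Qed.

HB.instance Definition _ :=
  GRing.isSubringClosed.Build (mollifier -> K) moderate moderate_subring_closed.

Record moderate_family := ModerateFamily {
  moderate_fun :> mollifier -> K;
  moderate_funP : moderate_fun \in moderate }.

HB.instance Definition _ := [isSub for moderate_fun].
HB.instance Definition _ := [Choice of moderate_family by <:].
HB.instance Definition _ := 
  GRing.SubChoice_isSubComPzRing.Build _ _ moderate_family moderate_subring_closed.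

Definition null_family : {pred moderate_family} :=
  [pred u | `[< null_bound (fun phi => modulus (moderate_fun u phi)) >]].

Lemma null_family_zmod_closed : zmod_closed null_family.
Proof.
split.
  apply/asboolP; apply: null_bound_le null_bound0 => phi.
  by rewrite modulus0.
move=> u v /asboolP hu /asboolP hv; apply/asboolP.
by apply: null_boundD hu hv _ => phi; rewrite (le_trans (modulusD _ _)) // modulusN.
Qed.

HB.instance Definition _ :=
  GRing.isZmodClosed.Build moderate_family null_family null_family_zmod_closed.

Definition generalized_scalars := Quotient.quot null_family.

HB.instance Definition _ := GRing.Zmodule.on generalized_scalars.

Definition approx0 (v : mollifier -> K) : Prop := exists p, forall phi,
  normalized_A p phi -> v (rescale phi eps) @[eps --> 0^'+] --> (0 : K).

(* Being associated with 0 only depends on the class, so that the choice of the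
   representative [repr x] is immaterial. *)
Definition sharp_valuation (x : generalized_scalars) : \bar R :=
  ereal_sup [set r%:E | r in [set r : R |
    approx0 (fun phi => of_real (diam phi `^ (- r)) * moderate_fun (repr x) phi)]].

(* Extended-real-valued, but finite: x is moderate, so the valuation is never
   -oo; it is +oo for x = 0, and expeR -oo = 0. *)
Definition sharp_norm (x : generalized_scalars) : \bar R :=
  expeR (- sharp_valuation x).

Definition sharp_open (A : set generalized_scalars) : Prop :=
  forall x, A x -> exists2 r : R, 0 < r &
    [set y | (sharp_norm (x - y)%R < r%:E)%E] `<=` A.

Let sharp_openT : sharp_open setT.
Proof. by move=> x _; exists 1. Qed.

Let sharp_openI (A B : set generalized_scalars) :
  sharp_open A -> sharp_open B -> sharp_open (A `&` B).
Proof.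
move=> oA oB x [/oA[r r0 rA] /oB[s s0 sB]].
exists (Num.min r s); first by rewrite lt_min r0.
move=> y /=; rewrite EFin_min lt_min => /andP[yr ys].
by split; [exact: rA|exact: sB].
Qed.

Let sharp_open_bigcup (I : Type) (A : I -> set generalized_scalars) :
  (forall i, sharp_open (A i)) -> sharp_open (\bigcup_i A i).
Proof.
by move=> oA x [i _ /oA[r r0 rA]]; exists r => // y /rA Ay; exists i.
Qed.

HB.instance Definition _ := isOpenTopological.Build generalized_scalars
  sharp_openT sharp_openI sharp_open_bigcup.

End GeneralizedScalars.

Arguments moderate {R k}.
Arguments null_bound0 {R k}.

Section SmoothFunctions.
Variables (R : realType) (n : nat).

(* g is total; for Omega open the values of g outside Omega do not matter at
   the points of Omega. *)
Fixpoint iterated_partial (s : seq 'I_n) (g : 'rV[R]_n -> R) : 'rV[R]_n -> R :=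
  if s is i :: s' then fun x => 'D_(delta_mx 0 i) (iterated_partial s' g) x else g.

Definition smooth_real (Omega : set 'rV[R]_n) (g : 'rV[R]_n -> R) : Prop :=
  forall s x, Omega x -> {for x, continuous (iterated_partial s g)} /\
    forall i, derivable (iterated_partial s g) x (delta_mx 0 i).

Variable k : scalar_kind.

Definition smooth (Omega : set 'rV[R]_n) (f : 'rV[R]_n -> scalars R k) : Prop :=
  smooth_real Omega (fun x => real_part (f x)) /\
  smooth_real Omega (fun x => imag_part (f x)).

Definition open_mapping (Omega : set 'rV[R]_n) (f : 'rV[R]_n -> scalars R k) : Prop :=
  forall U, open U -> U `<=` Omega -> open (f @` U).

End SmoothFunctions.

Section GeneralizedPoints.
Variables (R : realType) (k : scalar_kind) (n : nat).
Local Notation K := (scalars R k).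
Local Notation mollifier := (mollifier R k).

(* Families of points of W that stay, for small eps, in a compact part of W. *)
Definition compactly_supported (W : set 'rV[R]_n) : {pred mollifier -> 'rV[R]_n} :=
  [pred x | `[< (forall phi, W (x phi)) /\
    exists (L : set 'rV[R]_n) (p : nat), [/\ compact L, L `<=` W &
      forall phi, normalized_A p phi -> exists2 eta, 0 < eta <= 1 &
        forall eps, 0 < eps < eta -> L (x (rescale phi eps))] >]].

Record point_family (W : set 'rV[R]_n) := PointFamily {
  point_fun :> mollifier -> 'rV[R]_n;
  point_funP : point_fun \in compactly_supported W }.

Variable Omega : set 'rV[R]_n.

HB.instance Definition _ := [isSub for @point_fun Omega].
HB.instance Definition _ := [Choice of point_family Omega by <:].

Definition point_equiv : rel (point_family Omega) :=
  fun x y => `[< null_bound (fun phi => `|x phi - y phi|) >].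

Let point_equiv_is_equiv : equiv_class_of point_equiv.
Proof.
split=> [x|x y|y x z].
- by apply/asboolP; apply: null_bound_le null_bound0 => phi; rewrite subrr normr0.
- rewrite /point_equiv; congr asbool; congr null_bound.
  by apply/funext => phi; rewrite distrC.
- move=> /asboolP xy /asboolP yz; apply/asboolP.
  by apply: null_boundD xy yz _ => phi; exact: ler_distD.
Qed.

Canonical point_equiv_equiv := EquivRelPack point_equiv_is_equiv.
Canonical point_equiv_encModRel := defaultEncModRel point_equiv.

Definition generalized_points := {eq_quot point_equiv}.

(* The copy of the generalized points of W inside those of Omega, for
   W included in Omega. *)
Definition points_in (W : set 'rV[R]_n) : set generalized_points :=
  [set x | exists2 y : point_family Omega,
    point_fun y \in compactly_supported W & x = \pi_(generalized_points) y].

Lemma moderate_comp (f : 'rV[R]_n -> K) (x : point_family Omega) :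
  smooth Omega f -> (f \o x) \in moderate.
Proof.
move=> [sre sim]; have /asboolP[_ [L [p [cL LO xL]]]] := point_funP x.
have bnd (g : 'rV[R]_n -> R) : smooth_real Omega g ->
    exists2 M, 0 < M & forall y, L y -> `|g y| <= M.
  move=> sg; have : compact (g @` L).
    apply: continuous_compact => //; apply: continuous_in_subspaceT => y /set_mem Ly.
    by have [] := sg [::] y (LO _ Ly).
  move=> /compact_bounded [M [_ hM]]; exists (`|M| + 1); first by rewrite ltr_wpDl.
  move=> y Ly; apply: (hM (`|M| + 1)); last by exists y.
  by rewrite (le_lt_trans (ler_norm _)) // ltrDl.
have [M1 M10 h1] := bnd _ sre; have [M2 M20 h2] := bnd _ sim.
apply/asboolP; exists p => phi Aphi; have [eta e0 he] := xL _ Aphi.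
exists (M1 + M2), eta; split => //; first exact: addr_gt0.
move=> eps /[dup] /he Lx /andP[ep0 ep1].
have eps1 : eps <= 1 by rewrite ltW // (lt_le_trans ep1) //; case/andP: e0.
rewrite (le_trans (modulus_le _)) // (@le_trans _ _ (M1 + M2)) //.
  by rewrite lerD // (h1, h2).
by rewrite ler_pMr ?addr_gt0 // -exprVn exprn_ege1 // invf_ge1.
Qed.

(* Computed on the representative [repr x]; by [kappa_pi] below any other
   representative gives the same class. *)
Definition kappa (f : 'rV[R]_n -> K) (sf : smooth Omega f)
    (x : generalized_points) : generalized_scalars R k :=
  \pi_(generalized_scalars R k) (ModerateFamily (moderate_comp (repr x) sf)).

End GeneralizedPoints.

Arguments points_in {R k n} Omega W.

Section LipschitzOnCompacts.
Variables (R : realType) (n : nat).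
Implicit Types (g : 'rV[R]_n -> R).

Lemma line_is_derive g (z v : 'rV[R]_n) (t : R) :
  derivable g (z + t *: v) v ->
  is_derive t 1 (fun s : R => g (z + s *: v)) ('D_v g (z + t *: v)).
Proof.
move=> dg; have E : (fun h : R => h^-1 *: (((fun s : R => g (z + s *: v)) \o shift t) (h *: 1) - g (z + t *: v)))
  = (fun h => h^-1 *: ((g \o shift (z + t *: v)) (h *: v) - g (z + t *: v))).
  apply/funext => h /=; congr (_ *: (g _ - _)).
  by rewrite -[_%:A]/(h * 1) mulr1 scalerDl addrCA.
by apply: DeriveDef; rewrite /derivable /derive E.
Qed.

Lemma line_lipschitz g (z v : 'rV[R]_n) (a b M : R) : a <= b ->
  (forall t, a <= t <= b -> derivable g (z + t *: v) v /\ `|'D_v g (z + t *: v)| <= M) ->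
  `|g (z + b *: v) - g (z + a *: v)| <= M * (b - a).
Proof.
move=> ab H.
have [||c + ->] := @MVT_segment _ (fun s : R => g (z + s *: v)) (fun s => 'D_v g (z + s *: v)) a b ab.
- move=> x; rewrite in_itv /= => /andP[/ltW ax /ltW xb].
  by apply: line_is_derive; apply: (H _ _).1; rewrite ax.
- apply: derivable_within_continuous => x; rewrite in_itv /= => xab.
  by have [] := line_is_derive (H _ xab).1.
- rewrite in_itv /= => cab; rewrite normrM (@ger0_norm _ (b - a)) ?subr_ge0 //.
  by rewrite ler_wpM2r ?subr_ge0 //; apply: (H _ cab).2.
Qed.

Lemma line_lipschitz0 g (z v : 'rV[R]_n) (b M : R) : 
  (forall t, 0 <= t <= b \/ b <= t <= 0 -> derivable g (z + t *: v) v /\ `|'D_v g (z + t *: v)| <= M) ->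
  `|g (z + b *: v) - g z| <= M * `|b|.
Proof.
move=> H; have [b0|b0] := leP 0 b.
  have := @line_lipschitz g z v 0 b M b0; rewrite scale0r addr0 subr0 (ger0_norm b0); apply.
  by move=> t tb; apply: H; left.
have := @line_lipschitz g z v b 0 M (ltW b0); rewrite scale0r addr0 sub0r.
rewrite distrC (ltr0_norm b0); apply.
by move=> t tb; apply: H; right.
Qed.

Lemma normv_lt (x : 'rV[R]_n) e : 0 < e -> (`|x| < e) <-> (forall i, `|x 0 i| < e).
Proof.
move=> e0; rewrite [`|x|]mx_normrE; split.
  by move=> /bigmax_ltP[_ h] i; have := h (0, i) isT.
by move=> h; apply/bigmax_ltP; split => // -[i j] _ /=; rewrite ord1.
Qed.

Lemma coord_le (x : 'rV[R]_n) i : `|x 0 i| <= `|x|.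
Proof.
by rewrite [`|x|]mx_normrE; apply/bigmax_geP; right; exists (0, i).
Qed.

Lemma box_lipschitz g (a x y : 'rV[R]_n) (r M : R) : 0 < r -> 0 <= M ->
  (forall z, `|z - a| < r -> forall i, derivable g z (delta_mx 0 i) /\
       `|'D_(delta_mx 0 i) g z| <= M) ->
  `|x - a| < r -> `|y - a| < r -> `|g x - g y| <= n%:R * M * `|x - y|.
Proof.
move=> r0 M0 H /(normv_lt _ r0) xa /(normv_lt _ r0) ya.
pose z (j : nat) : 'rV[R]_n := \row_i (if (i < j)%N then y 0 i else x 0 i).
have z0 : z 0%N = x by apply/rowP => i; rewrite mxE.
have zn : z n = y by apply/rowP => i; rewrite mxE ltn_ord.
have step (j : 'I_n) : `|g (z j.+1) - g (z j)| <= M * `|x - y|.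
  pose b := y 0 j - x 0 j.
  have zS : z j.+1 = z j + b *: delta_mx 0 j.
    apply/rowP => i; rewrite !mxE eqxx /= ltnS leq_eqVlt.
    have [->|ij] := eqVneq i j; first by rewrite eqxx /= ltnn mulr1 addrC subrK.
    by rewrite mulr0 addr0; have /negPf -> : (i != j :> nat) by [].
  have : `|g (z j + b *: delta_mx 0 j) - g (z j)| <= M * `|b|.
    apply: line_lipschitz0 => t tb; apply: H; apply/normv_lt => // i.
    rewrite !mxE eqxx /=; have [->|ij] := eqVneq i j; last first.
      by rewrite mulr0 addr0; case: ifP => _; [have := ya i|have := xa i]; rewrite !mxE.
    have := xa j; have := ya j; rewrite ltnn mulr1 !mxE !ltr_norml.
    by move=> /andP[y1 y2] /andP[x1 x2]; rewrite /b in tb; case: tb => /andP[t1 t2]; lra.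
  rewrite -zS => /le_trans -> //; rewrite ler_wpM2l // /b distrC.
  by have := coord_le (x - y) j; rewrite !mxE.
rewrite distrC -zn -z0 -(@telescope_sumr _ 0 n (fun j => g (z j))) //.
rewrite big_mkord (le_trans (ler_norm_sum _ _ _)) //.
rewrite (le_trans (ler_sum _ (fun j _ => step j))) //.
by rewrite sumr_const card_ord -mulrA mulr_natl z0 zn.
Qed.

Lemma compact_lipschitz g (Omega L : set 'rV[R]_n) : open Omega ->
  smooth_real Omega g -> compact L -> L `<=` Omega ->
  exists2 M : R, 0 < M & forall x y, L x -> `|x - y| < M^-1 ->
    `|g x - g y| <= M * `|x - y|.
Proof.
move=> oO sg cL LO.
pose P (M : R) (x : 'rV[R]_n) := forall y, `|x - y| < M^-1 ->
    `|g x - g y| <= M * `|x - y|.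
suff : \forall M \near +oo, L `<=` P M.
  move=> PM; have M0 : \forall M \near +oo, (0 : R) < M.
    by apply: nbhs_pinfty_gt; exact: num_real.
  by have [M [/= Mp hM]] := filter_ex (filterI M0 PM); exists M => // x y /hM; apply.
apply: (compact_near_coveringP _).1 => // a La.
have Oa := LO _ La.
pose D i := 'D_(delta_mx 0 i) g.
pose M0 := 1 + \sum_i `|D i a|.
have M01 : 1 <= M0 by rewrite lerDl sumr_ge0.
have DM0 i : `|D i a| < M0.
  by rewrite /M0 (bigD1 i) //= addrCA ltrDl ltr_pwDl // sumr_ge0.
have : \forall z \near a, Omega z /\ forall i, `|D i z| <= M0.
  near=> z; split; near: z; first exact: open_nbhs_nbhs.
  apply: filter_forall => i.
  have [cD _] := sg [:: i] a Oa.
  have : \forall z \near a, `|D i z| < M0.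
    have /cvg_norm cDn : D i z @[z --> a] --> D i a by exact: cD.
    exact: (cvgr_lt _ cDn _ (DM0 i)).
  by apply: filterS => z /ltW.
move=> /nbhs_ballP[e /= e0 he].
have key x y : `|x - a| < e -> `|y - a| < e -> `|g x - g y| <= n%:R * M0 * `|x - y|.
  move=> xa ya; apply: box_lipschitz xa ya => //; first by rewrite (le_trans _ M01).
  move=> z za i; have [Oz hz] : Omega z /\ forall i, `|D i z| <= M0.
    by apply: he; rewrite -ball_normE /= distrC.
  by split; [have [_] := sg [::] z Oz; apply|exact: hz].
have e20 : 0 < e / 2 by rewrite divr_gt0.
near=> x M => y xy.
have M0' : 0 < M by near: M; apply: nbhs_pinfty_gt; exact: num_real.
have xa : `|x - a| < e / 2.
  by rewrite distrC; near: x; apply/nbhs_ballP; exists (e / 2) => //= z; rewrite -ball_normE.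
have Me : M^-1 < e / 2.
  rewrite invf_plt ?posrE //; near: M; apply: nbhs_pinfty_gt; exact: num_real.
have nM : n%:R * M0 <= M by near: M; apply: nbhs_pinfty_ge; exact: num_real.
apply: le_trans (key _ _ _ _) _.
- by rewrite (lt_trans xa) // ltr_pdivrMr // ltr_pMr // ltr1n.
- rewrite -(subrKA x) (le_lt_trans (ler_normD _ _)) // (splitr e) ltrD //.
  by rewrite distrC (lt_trans xy).
- by rewrite ler_wpM2r.
Unshelve. all: by end_near. Qed.

End LipschitzOnCompacts.

Section KappaWellDefined.
Variables (R : realType) (k : scalar_kind) (n : nat).
Variables (Omega : set 'rV[R]_n) (f : 'rV[R]_n -> scalars R k).

Lemma scalar_lipschitz L : open Omega -> smooth Omega f -> compact L -> L `<=` Omega ->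
  exists2 M : R, 0 < M & forall x y, L x -> `|x - y| < M^-1 ->
    modulus (f x - f y) <= M * `|x - y|.
Proof.
move=> oO [s1 s2] cL LO.
have [M1 M10 h1] := compact_lipschitz oO s1 cL LO.
have [M2 M20 h2] := compact_lipschitz oO s2 cL LO.
exists (M1 + M2); first exact: addr_gt0.
move=> x y Lx xy; rewrite (le_trans (modulus_le _)) // mulrDl.
have rB : real_part (f x - f y) = real_part (f x) - real_part (f y).
  by rewrite /real_part; case: (k) (f x) (f y) => // -[? ?] [? ?].
have iB : imag_part (f x - f y) = imag_part (f x) - imag_part (f y).
  rewrite /imag_part; case: (k) (f x) (f y) => [? ?|]; [by rewrite /= subrr|by move=> -[? ?] [? ?]].
rewrite rB iB lerD //; [apply: h1|apply: h2] => //.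
  by rewrite (lt_le_trans xy) // lef_pV2 ?posrE ?addr_gt0 // lerDl ltW.
by rewrite (lt_le_trans xy) // lef_pV2 ?posrE ?addr_gt0 // lerDr ltW.
Qed.

(* kappa(f) is well defined on classes. *)
Lemma kappa_pi (oO : open Omega) (sf : smooth Omega f) (x : point_family k Omega) :
  kappa sf (\pi_(generalized_points k Omega) x) =
  \pi_(generalized_scalars R k) (ModerateFamily (moderate_comp x sf)).
Proof.
rewrite /kappa; set y := repr _.
have : (y = x %[mod generalized_points k Omega]) by rewrite reprK.
move=> /eqP; rewrite eqmodE => /asboolP [N [g [[g0 gi gy] h]]].
apply/eqP; rewrite -Quotient.idealrBE; apply/asboolP => /=.
have /asboolP[_ [L [p [cL LO yL]]]] := point_funP y.
have [M M0 hM] := scalar_lipschitz oO sf cL LO.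
have [N1 [NN1 gN1]] : exists N1, (N + p <= N1)%N /\ N%:R + 1 <= g N1.
  near \oo => m; exists m; split; near: m; first exact: nbhs_infty_ge.
  exact: (cvgryPge _).1.
exists N1, g; split => // q phi N1q Aphi.
have [c [e [c0 /andP[e0 e1] hc]]] := h q phi (leq_trans (leq_trans (leq_addr _ _) NN1) N1q) Aphi.
have Aphi' : normalized_A p phi.
  by apply: normalized_A_le Aphi; rewrite (leq_trans _ N1q) // (leq_trans _ NN1) ?leq_addl.
have [e' /andP[e'0 e'1] hL] := yL phi Aphi'.
have gq : N%:R + 1 <= g q.
  have [->//|N1q'] := eqVneq q N1.
  by rewrite (le_trans gN1) // ltW // gi // ltn_neqAle eq_sym N1q'.
pose e2 := Num.min (Num.min e e') ((c * M *+ 2)^-1).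
exists (M * c), e2; split; first exact: mulr_gt0.
  rewrite /e2 !lt_min e0 e'0 invr_gt0 pmulrn_rgt0 // ?mulr_gt0 //=.
  by rewrite !ge_min e1.
move=> eps /andP[ep0]; rewrite !lt_min => /andP[/andP[epe epe'] epc].
have epsle1 : eps <= 1 by rewrite ltW // (lt_le_trans epe).
have b1 := hc _ (introT andP (conj ep0 epe)).
have b2 : `|y (rescale phi eps) - x (rescale phi eps)| < M^-1.
  rewrite (le_lt_trans b1) // (@le_lt_trans _ _ (c * eps)) //.
    rewrite ler_wpM2l ?(ltW c0) // -[leRHS]powRr1 ?(ltW ep0) //.
    by apply: ger_powR; rewrite ?ep0 // lerBrDr addrC.
  rewrite mulrC -ltr_pdivlMr // (lt_trans epc) // -invfM mulrC ltf_pV2 ?posrE ?mulr_gt0 //.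
    by rewrite mulr2n ltrDl mulr_gt0.
  by rewrite pmulrn_rgt0 // mulr_gt0.
apply: le_trans (hM _ _ (hL _ _) b2) _; first by rewrite ep0.
rewrite -mulrA ler_wpM2l ?(ltW M0) // (le_trans b1) // ler_wpM2l ?(ltW c0) //.
apply: ger_powR; first by rewrite ep0.
by rewrite lerB // ler_nat (leq_trans _ NN1) // leq_addr.
Unshelve. all: by end_near. Qed.
End KappaWellDefined.

(* Main.v *)
Require Import Defs.
From mathcomp Require Import all_boot all_order all_algebra.
From mathcomp Require Import all_classical all_reals all_analysis.
Import numFieldNormedType.Exports.
Import Order.TTheory GRing.Theory Num.Theory.

Local Open Scope classical_set_scope.
Local Open Scope ring_scope.
Local Open Scope quotient_scope.

(** The image contains the ball of radius 1 about each of its points, because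
    being close to [f x] in the sharp topology forces honest convergence. Let
    [x] be represented by a family living in a compact [L] of [W], and let
    [y] satisfy [sharp_norm (kappa f x - y) < 1]. The valuation of the
    difference is then positive, so some positive power of [i(phi)] can be
    factored out of it and its representatives tend to 0 along
    [rescale phi eps] ([sharp_norm_lt1]).

    An open continuous map is open uniformly on compact sets: for a fixed [d]
    there is one [del] such that, for every [a] in [L], each scalar within [del]
    of [f a] is the value of [f] at a point within [d] of [a]
    ([uniform_openness]). With [d] so small that the closed [d]-neighbourhood of
    [L] is still a compact part of [W] ([compact_thickening],
    [thickening_sub]), the representative of [y] at [rescale phi eps] is, for
    [eps] small, exactly the value of [f] at a point of this neighbourhood. A
    choice of such points is a compactly supported family [z] with
    [f (z phi) = y phi] for all small rescalings, hence [kappa f z = y]. *)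

(** * Real moduli of scalars *)

Section RealModulus.
Context {R : realType} {k : scalar_kind}.
Implicit Types (a b : R) (z : scalars R k).

Lemma of_real_lt a b : (@of_real R k a < of_real b) = (a < b).
Proof.
rewrite !lt_neqAle of_real_le; congr (~~ _ && _); apply/eqP/eqP => [|->//] e.
by apply/eqP; rewrite eq_le -!(@of_real_le R k) e lexx.
Qed.

Lemma of_real0 : @of_real R k 0 = 0.
Proof. by apply/eqP; rewrite of_real_eq0. Qed.

Lemma modulus_of_real a : modulus (@of_real R k a) = `|a|.
Proof.
by rewrite /modulus /of_real; case: (k) => //=; rewrite expr0n addr0 sqrtr_sqr.
Qed.

(** Radii of balls in [scalars R k] are elements of that field; taking their
    modulus turns them into reals uniformly in the two kinds of scalars. *)
Lemma nbhs_modulus z (A : set (scalars R k)) : nbhs z A ->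
  exists2 d : R, 0 < d & forall w, modulus (w - z) < d -> A w.
Proof.
move=> /nbhs_ballP[e /= e0 eA]; exists (modulus e).
  by rewrite -(@of_real_lt 0) modulusE of_real0 normr_gt0 gt_eqF.
move=> w wz; apply: eA; rewrite -ball_normE /= distrC -modulusE.
by rewrite -[e]gtr0_norm // -modulusE of_real_lt.
Qed.

Lemma cvg0_modulus {T} {F : set_system T} {FF : Filter F} (u : T -> scalars R k) d :
  u @ F --> 0 -> 0 < d -> \forall t \near F, modulus (u t) < d.
Proof.
move=> /cvgr0Pnorm_lt u0 d0; have := u0 (of_real d).
rewrite -of_real0 of_real_lt => /(_ d0); apply: filterS => t.
by rewrite -modulusE of_real_lt.
Qed.

End RealModulus.

(** * The open unit ball of the sharp norm *)

Section Association.
Context {R : realType} {k : scalar_kind}.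
Local Notation mollifier := (mollifier R k).

(** Association with 0, as in [approx0], for real-valued bounds such as moduli
    of families. *)
Definition infinitesimal (a : mollifier -> R) : Prop :=
  exists p, forall phi, normalized_A p phi -> forall d, 0 < d ->
    \forall eps \near 0^'+, a (rescale phi eps) < d.

Lemma infinitesimalD (a b : mollifier -> R) (c : mollifier -> R) :
  infinitesimal a -> infinitesimal b -> (forall phi, c phi <= a phi + b phi) ->
  infinitesimal c.
Proof.
move=> [p hp] [q hq] cab; exists (p + q)%N => phi Aphi d d0.
have d20 : 0 < d / 2 by rewrite divr_gt0.
have := hp phi (normalized_A_le (leq_addr _ _) Aphi) _ d20.
have := hq phi (normalized_A_le (leq_addl _ _) Aphi) _ d20.
apply: filterS2 => e he1 he2; rewrite (le_lt_trans (cab _)) // (splitr d).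
exact: ltrD.
Qed.

(** Once [q] is so large that the exponent [g q - N] is at least 1, the bound is
    at most [c * eps]. *)
Lemma null_infinitesimal (a : mollifier -> R) : null_bound a -> infinitesimal a.
Proof.
move=> [N [g [[_ gi gy] h]]].
have [q [Nq gq]] : exists q, (N <= q)%N /\ N%:R + 1 <= g q.
  near \oo => m; exists m; split; near: m; first exact: nbhs_infty_ge.
  exact: (cvgryPge _).1.
exists q => phi Aphi d d0; have [c [eta [c0 /andP[eta0 eta1] hc]]] := h q phi Nq Aphi.
near=> eps.
have e0 : 0 < eps by near: eps; exact: nbhs_right_gt.
have ee : eps < eta by near: eps; exact: nbhs_right_lt.
have ed : eps < d / c by near: eps; apply: nbhs_right_lt; exact: divr_gt0.
rewrite (le_lt_trans (hc _ _)) ?e0 // mulrC -ltr_pdivlMr // (le_lt_trans _ ed) //.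
rewrite -[leRHS]powRr1 ?(ltW e0) //; apply: ger_powR; last by rewrite lerBrDr addrC.
by rewrite e0 ltW // (lt_le_trans ee).
Unshelve. all: by end_near. Qed.

Lemma continuous_closure {T U : topologicalType} (g : T -> U) (A : set T) (B : set U) x :
  continuous g -> (forall y, A y -> B (g y)) -> closure A x -> closure B (g x).
Proof.
move=> cg AB clA C /cg nC; have [y [Ay Cy]] := clA _ nC.
by exists (g y); split => //; exact: AB.
Qed.

Lemma sval_rescale (phi : mollifier) eps : 0 < eps ->
  sval (rescale phi eps) = rescale_fun eps (sval phi).
Proof. by rewrite /rescale; case: {-}_ / idP => // n /n. Qed.

Lemma support_rescale (phi : mollifier) eps x : 0 < eps ->
  Defs.support (sval (rescale phi eps)) (eps * x) <-> Defs.support (sval phi) x.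
Proof.
move=> e0; rewrite sval_rescale //.
have e1 : eps != 0 by rewrite gt_eqF.
have ei : of_real eps^-1 != 0 :> scalars R k by rewrite of_real_eq0 invr_eq0.
have cM (c : R) : continuous (fun y : R => c * y).
  by move=> y; apply: cvgMl_tmp; exact: cvg_id.
split => [sx|].
  rewrite -[x](mulKf e1); apply: (continuous_closure _ _ _ _ (cM eps^-1) _ sx) => y /=.
  by rewrite /rescale_fun mulf_eq0 negb_or => /andP[_]; rewrite mulrC.
apply: (continuous_closure _ _ _ _ (cM eps)) => y /= py.
by rewrite /rescale_fun mulf_neq0 // [eps * y]mulrC mulfK.
Qed.

(** The normalization [diam phi = 1] also guarantees that the set of distances
    is nonempty and bounded, since an ill-defined [sup] would be 0. *)
Lemma diam_rescale (phi : mollifier) eps : 0 < eps -> diam phi = 1 ->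
  diam (rescale phi eps) = eps.
Proof.
move=> e0; rewrite /diam; set S := [set _ | _ in _]; set S' := [set _ | _ in _] => S1.
have [[s0 Ss0] ubS] : has_sup S.
  by apply: contrapT => /sup_out; rewrite S1 => /eqP; rewrite oner_eq0.
have e1 : eps != 0 by rewrite gt_eqF.
have SS' s : S s -> S' (eps * s).
  move=> [[x y] [/= sx sy] <-]; exists (eps * x, eps * y).
    by split; apply/(support_rescale phi _ _ e0).
  by rewrite /= -mulrBr normrM gtr0_norm.
have S'S s : S' s -> s <= eps.
  move=> [[x y] [/=]]; rewrite -[x](mulVKf e1) -[y](mulVKf e1).
  move=> /support_rescale - /(_ e0) sx /support_rescale - /(_ e0) sy <-.
  rewrite -mulrBr normrM gtr0_norm // ger_pMr // -S1.
  by apply: ub_le_sup => //; exists (x / eps, y / eps); rewrite // ![_ / _]mulrC.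
apply/eqP; rewrite eq_le; apply/andP; split.
  by apply: ge_sup => //; exists (eps * s0); exact: SS'.
rewrite -[leLHS]mulr1 -ler_pdivlMl // -S1; apply: ge_sup; first by exists s0.
move=> s /SS' Ss; rewrite ler_pdivlMl //.
by apply: ub_le_sup => //; exists eps.
Qed.

(** Norm less than 1 means positive valuation, so [eps `^ (- r) * u] tends to 0
    for some [r > 0]; as [eps `^ (- r) >= 1] for [eps <= 1], so does [u]. The
    valuation is computed on a canonical representative, which differs from [u]
    by a null family. *)
Lemma sharp_norm_lt1 (u : moderate_family R k) :
  (sharp_norm (\pi_(generalized_scalars R k) u) < 1)%E ->
  infinitesimal (fun phi => modulus (u phi)).
Proof.
rewrite -expeR0 lte_expeR -[X in (_ < X)%E]oppe0 lteN2 => /ereal_sup_gt[_ [r + <-]].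
set v := repr _; rewrite /= lte_fin => -[p vp] r0.
have vinf : infinitesimal (fun phi => modulus (v phi)).
  exists p => phi Aphi d d0.
  have dphi : diam phi = 1 by case: Aphi.
  near=> eps.
  have e0 : 0 < eps by near: eps; exact: nbhs_right_gt.
  have e1 : eps <= 1 by near: eps; apply: nbhs_right_le.
  have : modulus (of_real (diam (rescale phi eps) `^ (- r)) *
                  v (rescale phi eps)) < d.
    by near: eps; exact: cvg0_modulus (vp _ Aphi) d0.
  rewrite modulusM diam_rescale // modulus_of_real; apply: le_lt_trans.
  rewrite ler_peMl ?modulus_ge0 // ger0_norm ?powR_ge0 //.
  by rewrite -(powRr0 eps); apply: ger_powR; rewrite ?e0 // oppr_le0 ltW.
have : (u = v %[mod generalized_scalars R k]) by rewrite reprK.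
move=> /eqP; rewrite -Quotient.idealrBE => /asboolP/null_infinitesimal uv.
apply: infinitesimalD uv vinf _ => phi /=.
by rewrite (le_trans _ (modulusD _ _)) // subrK.
Unshelve. all: by end_near. Qed.

End Association.

(** * Uniform openness on compact sets *)

Section UniformOpenness.
Context {R : realType} {n : nat}.
Implicit Types (L W Omega : set 'rV[R]_n).

(** The closed neighbourhood for the sup norm, written in coordinates so that
    its compactness reduces to that of a product of segments, in every
    dimension including 0. *)
Definition thickening L (d : R) : set 'rV[R]_n :=
  [set x | exists2 a, L a & forall i, `|(x - a) 0 i| <= d].

(** The thickening is the image of the product of [L] and a box under
    addition. *)
Lemma compact_thickening L d : compact L -> compact (thickening L d).
Proof.
move=> cL; pose B : set 'rV[R]_n := [set v | forall i, `[- d, d]%classic (v ord0 i)].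
have cB : compact B by apply: (@rV_compact _ _ (fun=> `[- d, d]%classic)) => i; exact: segment_compact.
rewrite (_ : thickening L d = (fun p => p.1 + p.2) @` (L `*` B)).
  apply: continuous_compact; last exact: compact_setX.
  by apply: continuous_subspaceT => p; exact: add_continuous.
rewrite eqEsubset; split => x /=.
  move=> [a La xa]; exists (a, x - a); last by rewrite /= addrC subrK.
  by split => // i; rewrite /= in_itv /= -ler_norml xa.
move=> [[a b] [/= La Bb] <-]; exists a => // i.
by have := Bb i; rewrite /= in_itv /= -ler_norml [a + b]addrC addrK.
Qed.

(** Near each [a] in [L] one radius works for all neighbouring points;
    compactness, in the form of near coverings, makes it uniform on [L]. *)
Lemma thickening_sub L W : compact L -> open W -> L `<=` W ->
  exists2 d, 0 < d & thickening L d `<=` W.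
Proof.
move=> cL oW LW.
pose P (d : R) (a : 'rV[R]_n) := forall x, `|x - a| <= d -> W x.
have PL : \forall d \near 0^'+, L `<=` P d.
  apply: (compact_near_coveringP _).1 => // a La.
  have /nbhs_ballP[e /= e0 eW] : nbhs a W by apply: open_nbhs_nbhs; split => //; exact: LW.
  have e20 : 0 < e / 2 by rewrite divr_gt0.
  near=> b d => x xb.
  have db : d < e / 2 by near: d; exact: nbhs_right_lt.
  have ab : `|a - b| < e / 2.
    by near: b; apply/nbhs_ballP; exists (e / 2) => //= z; rewrite -ball_normE.
  apply: eW; rewrite -ball_normE /= -(subrKA b) (le_lt_trans (ler_normD _ _)) //.
  by rewrite (splitr e) ltrD // distrC (le_lt_trans xb).
near (0 : R)^'+ => d; exists d; first by near: d; exact: nbhs_right_gt.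
have d0 : 0 < d by near: d; exact: nbhs_right_gt.
have PdL : L `<=` P d by near: d.
move=> x [a La xa]; apply: (PdL a La).
by rewrite [`|_|]mx_normrE; apply: bigmax_le => [|[i j] _ /=]; rewrite ?ord1 // ltW.
Unshelve. all: by end_near. Qed.

(** The image of [ball a (d / 2)] contains a ball of radius [e] about [f a]. For
    [b] close to [a], the ball of radius [e / 2] about [f b] lies in the
    former by continuity of [f], while [ball a (d / 2)] lies within distance [d]
    of [b]. So [e / 2] works for all [b] near [a], and compactness concludes. *)
Lemma uniform_openness k Omega (f : 'rV[R]_n -> scalars R k) L d :
  open Omega -> smooth Omega f -> open_mapping Omega f ->
  compact L -> thickening L d `<=` Omega -> 0 < d ->
  exists2 del, 0 < del & forall a, L a -> forall w, modulus (w - f a) < del ->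
    exists2 z, thickening [set a] d z & f z = w.
Proof.
move=> oO sf opf cL LdO d0.
pose P (e : R) (a : 'rV[R]_n) := forall w, modulus (w - f a) < e ->
    exists2 z, `|z - a| < d & f z = w.
have PL : \forall e \near 0^'+, L `<=` P e.
  apply: (compact_near_coveringP _).1 => // a La.
  have d20 : 0 < d / 2 by rewrite divr_gt0.
  have sB : ball a (d / 2) `<=` Omega.
    move=> x; rewrite -ball_normE /= distrC => xa; apply: LdO; exists a => // i.
    rewrite (le_trans (coord_le _ _)) // (le_trans (ltW xa)) //.
    by rewrite ler_pdivrMr // ler_pMr // ler1n.
  have oB : open (ball a (d / 2)) by exact: ball_open.
  have nfB : nbhs (f a) (f @` ball a (d / 2)).
    by apply: open_nbhs_nbhs; split; [exact: opf|exists a => //; exact: ballxx].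
  have [e e0 eB] := nbhs_modulus _ _ nfB.
  have Oa : Omega a by apply: sB; exact: ballxx.
  (* Continuity of [f] at [a] comes as the Lipschitz bound on the compact
     set [set a]. *)
  have [|M M0 fM] := scalar_lipschitz oO sf (@compact_set1 _ a).
    by move=> _ ->.
  have e20 : 0 < e / 2 by rewrite divr_gt0.
  have nb (c : R) : 0 < c -> \forall x \near a, `|a - x| < c.
    by move=> c0; apply/nbhs_ballP; exists c => //= z; rewrite -ball_normE.
  near=> b eps => w wb.
  have ee : eps < e / 2 by near: eps; exact: nbhs_right_lt.
  have ba1 : `|a - b| < M^-1 by near: b; apply: nb; rewrite invr_gt0.
  have ba2 : `|a - b| < e / 2 / M by near: b; apply: nb; rewrite divr_gt0.
  have ba3 : `|a - b| < d / 2 by near: b; exact: nb.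
  have [z za fz] : (f @` ball a (d / 2)) w.
    apply: eB; rewrite -(subrKA (f b)) (le_lt_trans (modulusD _ _)) // (splitr e) ltrD //.
      exact: lt_trans wb ee.
    rewrite -modulusN opprB (le_lt_trans (fM a b erefl ba1)) //.
    by rewrite mulrC -ltr_pdivlMr.
  exists z => //; rewrite -(subrKA a) (le_lt_trans (ler_normD _ _)) // (splitr d) ltrD //.
  by move: za; rewrite -ball_normE /= distrC.
near (0 : R)^'+ => e; exists e; first by near: e; exact: nbhs_right_gt.
have PeL : L `<=` P e by near: e.
move=> a La w /(PeL a La)[z za fz]; exists z => //; exists a => // i.
by rewrite (le_trans (coord_le _ _)) // ltW.
Unshelve. all: by end_near. Qed.

End UniformOpenness.

(** * Openness of the image *)

Theorem corollary26 (R : realType) (k : scalar_kind) (n : nat)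
    (Omega : set 'rV[R]_n) (f : 'rV[R]_n -> scalars R k)
    (openOmega : open Omega) (smoothf : smooth Omega f)
    (openf : open_mapping Omega f)
    (W : set 'rV[R]_n) (openW : open W) (WOmega : W `<=` Omega) :
  open (kappa smoothf @` points_in Omega W).
Proof.
move=> _ [_ [x xW ->] <-]; exists 1 => // y.
have /asboolP[Wx [L [p [cL LW xL]]]] := xW.
rewrite kappa_pi // => /=; rewrite -[y]reprK; set v := repr y.
set u := ModerateFamily _; rewrite -(raddfB \pi_(generalized_scalars R k)).
move=> /sharp_norm_lt1[q uv].
have [d d0 LdW] := thickening_sub _ _ cL openW LW.
have LdO := subset_trans LdW WOmega.
have [del del0 fdel] := uniform_openness _ _ _ _ _ openOmega smoothf openf cL LdO d0.
(* The default value [x phi] keeps [z phi] in [W] when [v phi] cannot be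
   lifted. *)
pose lifts phi z := [/\ L (x phi), thickening [set x phi] d z & f z = v phi].
pose z phi := xget (x phi) (lifts phi).
have zP phi : L (x phi) -> modulus (v phi - f (x phi)) < del -> lifts phi (z phi).
  move=> Lx /(fdel _ Lx)[w wx fw]; apply: xgetI; exact: (And3 Lx wx fw).
have lifts_thick phi w : lifts phi w -> thickening L d w.
  by move=> [Lx [_ -> wx] _]; exists (x phi).
have zW phi : W (z phi).
  rewrite /z; case: xgetP => [w _ /lifts_thick /LdW//|_]; exact: Wx.
have zlifts phi : normalized_A (p + q) phi -> exists2 eta, 0 < eta <= 1 &
    forall eps, 0 < eps < eta -> lifts (rescale phi eps) (z (rescale phi eps)).
  move=> Aphi.
  have [eta1 /andP[eta10 eta11] Leta] := xL _ (normalized_A_le (leq_addr _ _) Aphi).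
  have := uv _ (normalized_A_le (leq_addl _ _) Aphi) del del0.
  move=> [eta2 /= eta20 ueta].
  exists (Num.min eta1 eta2); first by rewrite lt_min eta10 eta20 ge_min eta11.
  move=> eps /andP[e0]; rewrite lt_min => /andP[e1 e2].
  apply: zP; first by apply: Leta; rewrite e0.
  rewrite -modulusN opprB; apply: ueta => //.
  by rewrite /= sub0r normrN gtr0_norm.
have zcs V : W `<=` V -> z \in compactly_supported V.
  move=> WV; apply/asboolP; split=> [phi|]; first exact: WV.
  exists (thickening L d), (p + q)%N; split.
  - exact: compact_thickening.
  - exact: subset_trans LdW WV.
  - move=> phi /zlifts[eta eta0 zeta]; exists eta => // eps /zeta; exact: lifts_thick.
pose zf := PointFamily (zcs Omega WOmega).
exists (\pi_(generalized_points k Omega) zf).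
  by exists zf => //; apply: (zcs W).
rewrite kappa_pi //; apply/eqP; rewrite -Quotient.idealrBE; apply/asboolP => /=.
(* The two representatives agree for small [eps], so any rate [g] will do. *)
have [_ [g [Gg _]]] := @null_bound0 R k.
exists (p + q)%N, g; split => // m phi pqm /(normalized_A_le pqm) /zlifts[eta eta0 zeta].
exists 1, eta; split => // eps /zeta[_ _ fz].
rewrite [leLHS](_ : _ = modulus (f (z (rescale phi eps)) - v (rescale phi eps))) //.
by rewrite fz subrr modulus0 mul1r powR_ge0.
Qed.
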